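(* Let $N\ge1$, let $\Omega\subset\mathbb{R}^N$ be a bounded domain and $T>0$, and let $J$ and $\mathcal{G}$ satisfy the assumptions stated in the context. Let $u$ be a regular subsolution of the nonlocal Dirichlet problem with boundary datum $h_1(x,t)$ and initial datum $u_0(x)$, and let $v$ be a regular supersolution of the nonlocal Dirichlet problem with boundary datum $h_2(x,t)$ and initial datum $v_0(x)$. If $h_1(x,t)\le h_2(x,t)$ in $(\Omega_J\setminus\overline\Omega)\times(0,T)$ and $u_0(x)\le v_0(x)$ in $\overline\Omega$, then $u\le v$ in $\overline\Omega\times[0,T]$.
   Context: Notation: $u(y;x,t):=u(y,t)-u(x,t)$ and $\Omega_J:=\Omega+\operatorname{supp}(J)$. Assumptions on $J$: $J:\mathbb{R}^N\to\mathbb{R}$ is a nonnegative radially symmetric function with $J\in\mathcal{C}_c(\mathbb{R}^N)$, $\int_{\mathbb{R}^N}J(z)\,dz=1$ and $C(J):=\int_{\mathbb{R}^N}J(z)z_N^2\,dz<\infty$. Assumptions on $\mathcal{G}$: $\mathcal{G}:\mathbb{R}^N\times\mathbb{R}\to\mathbb{R}$ is a nonnegative Carathéodory function ($\mathcal{G}(\cdot,s)$ measurable for every $s\in\mathbb{R}$, $\mathcal{G}(x,\cdot)$ continuous for a.e. $x\in\mathbb{R}^N$) and there exist constants $\alpha_2\ge\alpha_1>0$ such that $$\alpha_1\le\frac{\mathcal{G}(x,s)s-\mathcal{G}(x,\sigma)\sigma}{s-\sigma}\le\alpha_2\qquad\text{for all } s,\sigma\in\mathbb{R},\ s\neq\sigma,\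 \text{and a.e. }x\in\mathbb{R}^N.$$ Regular subsolution with boundary datum $h\in\mathcal{C}((\Omega_J\setminus\overline\Omega)\times(0,T))$ and initial datum $u_0\in\mathcal{C}(\overline\Omega)$: a function $u$ (defined also on $\Omega_J\setminus\overline\Omega$, so that the integral below makes sense) with $u\in\mathcal{C}(\overline\Omega\times[0,T])$ and $u_t\in\mathcal{C}(\overline\Omega\times(0,T))$ satisfying $$\begin{cases} u_t(x,t)\le\displaystyle\int_{\Omega_J}J(x-y)\,u(y;x,t)\,\mathcal{G}(x,u(y;x,t))\,dy & \text{in }\overline\Omega\times(0,T),\\ u(x,t)\le h(x,t) & \text{in }(\Omega_J\setminus\overline\Omega)\times(0,T),\\ u(x,0)\le u_0(x) & \text{in }\overline\Omega.\end{cases}$$ A regular supersolution is defined analogously, replacing every ''$\le$'' by ''$\ge$''. *)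

(* Defs.v *)
From HB Require Import structures.
From mathcomp Require Import all_boot all_order all_algebra.
From mathcomp Require Import all_classical all_reals all_analysis.
From mathcomp Require Import measurable_realfun.

Set Implicit Arguments.
Unset Strict Implicit.
Unset Printing Implicit Defensive.

Import Order.TTheory GRing.Theory Num.Theory.
Import numFieldNormedType.Exports.

Local Open Scope classical_set_scope.
Local Open Scope ring_scope.

(* The space R^N with N >= 1 is 'rV[R]_n.+1, where N = n.+1; the sup norm of
   the library gives it its usual topology and bounded sets. *)

Section lebesgue_outer_measure.
Context {R : realType} {n : nat}.
Local Notation E := 'rV[R]_n.+1.
Implicit Types (c : E * E) (A B : set E) (C : nat -> E * E).

Definition box c : set E :=
  [set x | forall i, c.1 ord0 i < x ord0 i <= c.2 ord0 i].

Definition box_vol c : R :=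
  \prod_(i < n.+1) Num.max 0 (c.2 ord0 i - c.1 ord0 i).

Definition box_cover A : set (nat -> E * E) :=
  [set C | A `<=` \bigcup_k box (C k)].

Definition lebesgue_outer A : \bar R :=
  ereal_inf [set (\sum_(k <oo) (box_vol (C k))%:E)%E | C in box_cover A].

Local Open Scope ereal_scope.

Lemma box_vol_ge0 c : 0 <= (box_vol c)%:E.
Proof. by rewrite lee_fin prodr_ge0// => i _; rewrite le_max lexx. Qed.
Hint Resolve box_vol_ge0 : core.

Lemma box_vol0 : box_vol (0%R, 0%R) = 0%R.
Proof.
by rewrite /box_vol big_ord_recl/= mxE subr0 maxxx mul0r.
Qed.

Let lebesgue_outer_ge0 A : 0 <= lebesgue_outer A.
Proof.
by apply: le_ereal_inf_tmp => x [C AC <-{x}]; exact: nneseries_ge0.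
Qed.

Let lebesgue_outer0 : lebesgue_outer set0 = 0.
Proof.
apply/eqP; rewrite eq_le lebesgue_outer_ge0 andbT.
apply: ereal_inf_lbound; exists (fun=> (0%R, 0%R)) => //.
by rewrite eseries0// => k _ _; rewrite box_vol0.
Qed.

Let le_lebesgue_outer : {homo lebesgue_outer : A B / A `<=` B >-> A <= B}.
Proof.
move=> A B AB; apply/ereal_inf_le_tmp => x [C BC <-{x}].
by exists C => //; exact: subset_trans AB BC.
Qed.

Let lebesgue_outer_sigma_subadditive : sigma_subadditive lebesgue_outer.
Proof.
move=> A; have [[i ioo]|] := pselect (exists i, lebesgue_outer (A i) = +oo).
  rewrite (eseries_pinfty _ _ ioo) ?leey// => k _.
  by rewrite -ltNye (lt_le_trans _ (lebesgue_outer_ge0 _)).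
rewrite -forallNE => Aoo.
suff add2e (e : {posnum R}) : lebesgue_outer (\bigcup_k A k) <=
    \sum_(i <oo) lebesgue_outer (A i) + e%:num%:E.
  by apply/lee_addgt0Pr => _/posnumP[].
rewrite (le_trans _ (epsilon_trick _ _ _))//.
pose P k C := box_cover (A k) C /\
  \sum_(j <oo) (box_vol (C j))%:E <=
    lebesgue_outer (A k) + (e%:num / (2 ^ k.+1)%:R)%:E.
have [G PG] : {G : nat -> nat -> E * E & forall k, P k (G k)}.
  apply: (@choice _ _ P) => k; rewrite /P /lebesgue_outer.
  set S := (X in ereal_inf X); move infS : (ereal_inf S) => iS.
  case: iS infS => [r Sr|Soo|Soo].
  - have en1 : (0 < e%:num / (2 ^ k.+1)%:R)%R by [].
    have /(lb_ereal_inf_adherent en1) : ereal_inf S \is a fin_num by rewrite Sr.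
    move=> [x [C AC Cx] xS].
    by exists C; split => //; rewrite Cx -Sr; exact/ltW.
  - by have := Aoo k; rewrite /lebesgue_outer Soo.
  - by have := lebesgue_outer_ge0 (A k); rewrite /lebesgue_outer Soo.
pose m (p : nat * nat) := (box_vol (G p.1 p.2))%:E.
have m0 p : 0 <= m p by exact: box_vol_ge0.
apply: (@le_trans _ _ (\esum_(p in setT) m p)).
  apply: ereal_inf_lbound => /=.
  have /card_esym/ppcard_eqP[f] := card_nat2.
  exists (fun k => G (f k).1 (f k).2).
    move=> t [i _ Ait]; have [j _ Gijt] := (PG i).1 _ Ait.
    by exists (f^-1%FUN (i, j)) => //=; rewrite invK ?inE.
  rewrite -(esum_pred_image m f xpredT)// ?[fun=> _]set_true//.
  by rewrite image_eq.
rewrite (_ : esum _ _ = \sum_(i <oo) \sum_(j <oo) m (i, j)); last first.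
  pose J : nat -> set (nat * nat) := fun i => [set (i, j) | j in setT].
  rewrite (_ : setT = \bigcup_k J k); last first.
    by rewrite predeqE => -[a b]; split => // _; exists a => //; exists b.
  rewrite esum_bigcupT /=; last 2 first.
    - apply/trivIsetP => i j _ _ ij.
      rewrite predeqE => -[k l] /=; split => //= -[] [_] _ [<-{k} _].
      by move=> [l' _] [] /esym/eqP; rewrite (negbTE ij).
    - by move=> [k l].
  rewrite -(image_id [set: nat]) -fun_true esum_pred_image//; last first.
    by move=> k _; exact: esum_ge0.
  apply: eq_eseriesr => /= j _.
  rewrite -(esum_pred_image m (pair j) predT)//=; last first.
    by move=> ? ? _ _; exact: (@can_inj _ _ _ snd).
  by congr esum; rewrite predeqE => -[a b]; split; move=> [i _ <-]; exists i.
by apply: lee_nneseries => k *; [exact: nneseries_ge0|exact: (PG k).2].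
Qed.

HB.instance Definition _ := isOuterMeasure.Build R E lebesgue_outer
  lebesgue_outer0 lebesgue_outer_ge0 le_lebesgue_outer
  lebesgue_outer_sigma_subadditive.

End lebesgue_outer_measure.

(* R^N with the sigma-algebra of its Lebesgue measurable sets (those that
   satisfy Caratheodory's criterion), and the Lebesgue measure on it. *)
Definition lebesgueType (R : realType) (n : nat) :=
  caratheodory_type
    (lebesgue_outer : {outer_measure set 'rV[R]_n.+1 -> \bar R}).

Definition lebesgue_N {R : realType} {n : nat} :
    {measure set (lebesgueType R n) -> \bar R} :=
  [the {measure set _ -> \bar R} of
    (lebesgue_outer : {outer_measure set 'rV[R]_n.+1 -> \bar R})
      : set (lebesgueType R n) -> \bar R].

(* "The integral of f over D makes sense", possibly with an infinite value:
   f is measurable and its positive and negative parts do not both have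
   infinite integral. *)
Definition quasi_integrable d (T : measurableType d) (R : realType)
    (mu : {measure set T -> \bar R}) (D : set T) (f : T -> \bar R) : Prop :=
  measurable_fun D f /\
  ((\int[mu]_(x in D) f^\+ x < +oo)%E \/ (\int[mu]_(x in D) f^\- x < +oo)%E).

Section nonlocal_dirichlet.
Context {R : realType} {n : nat}.
Local Notation E := 'rV[R]_n.+1.
Implicit Types (Omega : set E) (J : E -> R) (G : E -> R -> R) (T : R).
Implicit Types (h u v : E -> R -> R) (w : E -> R).

Definition bounded_domain Omega : Prop :=
  [/\ Omega !=set0, open Omega, connected Omega & bounded_set Omega].

Definition euclidean_norm (x : E) : R := Num.sqrt (\sum_i x ord0 i ^+ 2).

Definition radially_symmetric J : Prop :=
  forall x y, euclidean_norm x = euclidean_norm y -> J x = J y.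

Definition supp J : set E := closure [set z | J z != 0].

Record kernel_assumptions J : Prop := {
  kernel_ge0 : forall z, 0 <= J z;
  kernel_radial : radially_symmetric J;
  kernel_continuous : continuous J;
  kernel_compact_supp : compact (supp J);
  kernel_integral : (\int[lebesgue_N]_z (J z)%:E = 1)%E;
  kernel_moment : (\int[lebesgue_N]_z (J z * z ord0 ord_max ^+ 2)%:E < +oo)%E
}.

Record nonlinearity_assumptions G : Prop := {
  nonlinearity_ge0 : forall x s, 0 <= G x s;
  nonlinearity_measurable :
    forall s, measurable_fun setT ((fun x => G x s) : lebesgueType R n -> R);
  nonlinearity_continuous : {ae lebesgue_N, forall x, continuous (G x)};
  nonlinearity_bounds : exists alpha1 alpha2 : R,
    [/\ 0 < alpha1, alpha1 <= alpha2 &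
      forall s sigma : R, s != sigma -> {ae lebesgue_N, forall x,
        alpha1 <= (G x s * s - G x sigma * sigma) / (s - sigma) <= alpha2}]
}.

Definition Omega_J Omega J : set E :=
  [set x + z | x in Omega & z in supp J].

Definition exterior Omega J : set E := Omega_J Omega J `\` closure Omega.

Definition nonlocal_integrand J G u (x : E) (t : R) : lebesgueType R n -> \bar R :=
  fun y => (J (x - y) * (u y t - u x t) * G x (u y t - u x t))%:E.

Definition nonlocal_operator Omega J G u (x : E) (t : R) : \bar R :=
  (\int[lebesgue_N]_(y in Omega_J Omega J) nonlocal_integrand J G u x t y)%E.

Definition boundary_datum Omega J T h : Prop :=
  {within exterior Omega J `*` `]0, T[, continuous (fun p : E * R => h p.1 p.2)}.

Definition initial_datum Omega w : Prop :=
  {within closure Omega, continuous w}.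

(* Only the values of u on closure Omega `*` `[0, T] and on
   exterior Omega J `*` `]0, T[ matter. *)
Record regular Omega J G T u : Prop := {
  regular_continuous :
    {within closure Omega `*` `[0, T], continuous (fun p : E * R => u p.1 p.2)};
  regular_derivable : forall (x : E) (t : R), closure Omega x -> t \in `]0, T[ ->
    derivable (u x) t 1;
  regular_derivative_continuous :
    {within closure Omega `*` `]0, T[, continuous (fun p : E * R => derive1 (u p.1) p.2)};
  regular_integral : forall (x : E) (t : R), closure Omega x -> t \in `]0, T[ ->
    quasi_integrable lebesgue_N (Omega_J Omega J) (nonlocal_integrand J G u x t)
}.

Record regular_subsolution Omega J G T h w u : Prop := {
  subsolution_boundary_datum : boundary_datum Omega J T h;
  subsolution_initial_datum : initial_datum Omega w;
  subsolution_regular : regular Omega J G T u;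
  subsolution_equation : forall (x : E) (t : R), closure Omega x -> t \in `]0, T[ ->
    ((derive1 (u x) t)%:E <= nonlocal_operator Omega J G u x t)%E;
  subsolution_boundary : forall (x : E) (t : R), exterior Omega J x -> t \in `]0, T[ ->
    u x t <= h x t;
  subsolution_initial : forall x : E, closure Omega x -> u x 0 <= w x
}.

Record regular_supersolution Omega J G T h w u : Prop := {
  supersolution_boundary_datum : boundary_datum Omega J T h;
  supersolution_initial_datum : initial_datum Omega w;
  supersolution_regular : regular Omega J G T u;
  supersolution_equation : forall (x : E) (t : R), closure Omega x -> t \in `]0, T[ ->
    ((derive1 (u x) t)%:E >= nonlocal_operator Omega J G u x t)%E;
  supersolution_boundary : forall (x : E) (t : R), exterior Omega J x -> t \in `]0, T[ ->
    u x t >= h x t;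
  supersolution_initial : forall x : E, closure Omega x -> u x 0 >= w x
}.

End nonlocal_dirichlet.

(* Main.v *)
(* At a positive maximum (x0, t1) of u - v - e t over the closure of Omega times
   [0, t], with t < T, the function w = u - v satisfies w_t >= e. Comparing the
   two integrals, where the increments of w are at most w(x0, t1) - w(x, t1) by
   maximality and by the order of the exterior data, gives
   w_t(x, t1) <= K (w(x0, t1) - w(x, t1)), but only at the points x where the
   bounds on G hold. Those are almost all x, hence dense in Omega because a
   nonempty open set is not null, so that letting x tend to x0 contradicts
   w_t(x0, t1) >= e. *)
Require Import Defs.
From mathcomp Require Import all_boot all_order all_algebra.
From mathcomp Require Import all_classical all_reals all_analysis.
From mathcomp Require Import measurable_realfun lra.
Set Implicit Arguments.
Unset Strict Implicit.
Unset Printing Implicit Defensive.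
Import Order.TTheory GRing.Theory Num.Theory.
Import numFieldNormedType.Exports.
Local Open Scope classical_set_scope.
Local Open Scope ring_scope.

(** * Lebesgue measure: open sets are measurable, bounded sets have finite measure *)

Lemma lebesgue_outer_le_cover (R : realType) (n : nat) (A : set 'rV[R]_n.+1)
    (C : nat -> 'rV[R]_n.+1 * 'rV[R]_n.+1) :
  A `<=` \bigcup_k box (C k) ->
  (lebesgue_outer A <= \sum_(k <oo) (box_vol (C k))%:E)%E.
Proof. by move=> AC; apply: ereal_inf_lbound; exists C. Qed.

(** The hyperplane $x_i = a$ cuts a box in two. Only the [i]-th factor of the volume changes, and
    the two new factors add up to the old one, even when a piece is empty. *)
Lemma box_vol_split (R : realType) (n : nat) (c : 'rV[R]_n.+1 * 'rV[R]_n.+1)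
    (i : 'I_n.+1) (a : R) :
  box_vol (c.1, \row_j (if j == i then Num.min (c.2 ord0 j) a else c.2 ord0 j)) +
  box_vol (\row_j (if j == i then Num.max (c.1 ord0 j) a else c.1 ord0 j), c.2) =
  box_vol c.
Proof.
rewrite /box_vol (bigD1 i)//= [X in _ + X = _](bigD1 i)//= [RHS](bigD1 i)//=.
rewrite !mxE eqxx.
rewrite [X in _ * X + _](eq_bigr (fun j => Num.max 0 (c.2 ord0 j - c.1 ord0 j)));
  last by move=> j /negbTE ji; rewrite mxE ji.
rewrite [X in _ + _ * X](eq_bigr (fun j => Num.max 0 (c.2 ord0 j - c.1 ord0 j)));
  last by move=> j /negbTE ji; rewrite mxE ji.
rewrite -mulrDl; congr (_ * _).
rewrite /Num.max /Num.min /Order.max /Order.min.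
case: (ltP (c.2 _ _) a) => ?; case: (ltP (c.1 _ _) a) => ?;
  by repeat case: ltP => ?; lra.
Qed.

(** Carathéodory's criterion: cutting every box of a cover of [X] along the hyperplane gives covers
    of the two parts of [X], with the same total volume. *)
Lemma measurable_halfspace (R : realType) (n : nat) (i : 'I_n.+1) (a : R) :
  measurable ([set x | x ord0 i <= a] : set (lebesgueType R n)).
Proof.
apply: le_caratheodory_measurable => X /=.
apply: le_ereal_inf_tmp => _ [C XC <-].
pose lo k := ((C k).1,
  \row_j (if j == i then Num.min ((C k).2 ord0 j) a else (C k).2 ord0 j)).
pose hi k := (\row_j (if j == i then Num.max ((C k).1 ord0 j) a else (C k).1 ord0 j),
  (C k).2).
rewrite (eq_eseriesr (g := fun k => (box_vol (lo k))%:E + (box_vol (hi k))%:E)%E);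
  last by move=> k _; rewrite -EFinD box_vol_split.
rewrite nneseriesD//; [|by move=> *; exact: box_vol_ge0..].
apply: leeD; apply: lebesgue_outer_le_cover => x [/XC[k _ Ckx] /= xa];
  exists k => // j; have /andP[l h] := Ckx j; rewrite /= mxE; case: eqVneq => [ji|_].
- by rewrite l le_min h ji.
- by rewrite l h.
- by rewrite h gt_max l ji ltNge andbT; apply/negP.
- by rewrite l h.
Qed.

Lemma open_lebesgue_measurable (R : realType) (n : nat) (U : set 'rV[R]_n.+1) :
  open U -> measurable (U : set (lebesgueType R n)).
Proof.
move=> oU.
(* An open set is the union of the boxes with rational corners that it contains, and there are only
   countably many of these. *)
pose B (p : 'rV[rat]_n.+1 * 'rV[rat]_n.+1) : set (lebesgueType R n) :=
  [set x | forall i, ratr (p.1 ord0 i) < x ord0 i <= ratr (p.2 ord0 i)].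
have mB p : measurable (B p).
  rewrite (_ : B p = \bigcap_(i in [set: 'I_n.+1])
      ([set x | x ord0 i <= ratr (p.2 ord0 i)] `\`
       [set x | x ord0 i <= ratr (p.1 ord0 i)])).
    apply: fin_bigcap_measurable => // i _.
    by apply: measurableD; exact: measurable_halfspace.
  apply/seteqP; split => x /= Bx i.
    by move=> _; have /andP[l h] := Bx i; split => //; apply/negP; rewrite -ltNge.
  by have [h /negP] := Bx i I; rewrite -ltNge => l; rewrite l h.
rewrite (_ : U = \bigcup_p (if `[< B p `<=` U >] then B p else set0)).
  apply: countable_bigcupT_measurable => // p.
  by case: asboolP => _ //; exact: measurable0.
apply/seteqP; split => [x Ux|x [p _]]; last by case: asboolP => // BU /BU.
have /nbhs_ballP[r /= r0 rU] : nbhs x U by exact: open_nbhs_nbhs.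
(* Corners within [r] of [x] on either side in each coordinate keep the box inside the sup-norm
   ball. *)
have [q xq] : {q : 'I_n.+1 -> rat &
    forall i, ratr (q i) \in `](x ord0 i - r), (x ord0 i)[}.
  by apply: (@choice _ _ (fun i q => ratr q \in `](x ord0 i - r), (x ord0 i)[)) => i;
    apply: rat_in_itvoo; lra.
have [p xp] : {p : 'I_n.+1 -> rat &
    forall i, ratr (p i) \in `](x ord0 i), (x ord0 i + r)[}.
  by apply: (@choice _ _ (fun i p => ratr p \in `](x ord0 i), (x ord0 i + r)[)) => i;
    apply: rat_in_itvoo; lra.
have BE (y : 'rV[R]_n.+1) : B (\row_i q i, \row_i p i) y <->
    forall i, ratr (q i) < y ord0 i <= ratr (p i).
  by split => By i; have := By i; rewrite /= !mxE.
exists (\row_i q i, \row_i p i) => //; case: asboolP => [_|].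
  apply/BE => i; have := xq i; have := xp i; rewrite !in_itv/= => /andP[? ?] /andP[? ?].
  by lra.
case => y /BE By; apply: rU; split=> // i j; rewrite (ord1 i).
have := xq j; have := xp j; have := By j; rewrite !in_itv/=.
move=> /andP[? ?] /andP[? ?] /andP[? ?].
by rewrite /ball/= ltr_norml; lra.
Qed.

Lemma lebesgue_outer_bounded_lty (R : realType) (n : nat) (A : set 'rV[R]_n.+1) :
  bounded_set A -> (lebesgue_outer A < +oo)%E.
Proof.
move=> /ex_strict_bound_gt0[M M0 AM].
(* One cube of half-side [M] does the covering; the remaining boxes are degenerate and have volume
   0. *)
pose C k : 'rV[R]_n.+1 * 'rV[R]_n.+1 :=
  if k == 0%N then (const_mx (- M), const_mx M) else (0, 0).
have AC : A `<=` \bigcup_k box (C k).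
  move=> x Ax; exists 0%N => // i /=; rewrite !mxE.
  have := AM x Ax; rewrite /= => xM.
  have : `|x ord0 i| < M.
    apply: le_lt_trans xM.
    rewrite [leRHS]/Num.norm /= mx_normrE; apply/bigmax_geP; right => /=.
    by exists (ord0, i).
  by rewrite ltr_norml => /andP[-> /ltW ->].
apply: le_lt_trans (lebesgue_outer_le_cover AC) _.
rewrite (nneseries_split 0 1); last by move=> *; exact: box_vol_ge0.
rewrite eseries0 ?adde0 ?big_nat1 ?ltry// => -[|k]//= _ _.
by rewrite box_vol0.
Qed.

(** * Translations, and the non-nullity of nonempty open sets *)

Lemma lebesgue_outer_shift_le (R : realType) (n : nat) (A : set 'rV[R]_n.+1)
    (a : 'rV[R]_n.+1) :
  (lebesgue_outer [set (x + a)%R | x in A] <= lebesgue_outer A)%E.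
Proof.
apply: le_ereal_inf_tmp => _ [C AC <-].
rewrite (eq_eseriesr (g := fun k =>
  (box_vol ((C k).1 + a, (C k).2 + a))%:E)); last first.
  move=> k _; congr EFin; apply: eq_bigr => i _; rewrite !mxE/=.
  by congr Num.max; rewrite opprD addrACA subrr addr0.
apply: lebesgue_outer_le_cover => _ [x Ax <-]; have [k _ Ckx] := AC _ Ax.
by exists k => // i; rewrite /= !mxE ltrD2r lerD2r.
Qed.

(* Translates of [U] by vectors that depend on a rational one cover R^N. *)
Lemma open_not_negligible (R : realType) (n : nat) (U : set 'rV[R]_n.+1) :
  lebesgue_outer [set: 'rV[R]_n.+1] != 0%E -> open U -> U !=set0 ->
  ~ lebesgue_N.-negligible (U : set (lebesgueType R n)).
Proof.
move=> /eqP muT oU [x Ux] [A [mA A0 UA]]; apply: muT.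
have /nbhs_ballP[r /= r0 rU] : nbhs x U by exact: open_nbhs_nbhs.
(* This vector moves [x] to the rational point [q], so the translate of the ball around [x] covers
   every point within [r] of [q]. *)
pose s (q : 'rV[rat]_n.+1) : 'rV[R]_n.+1 := map_mx ratr q - x.
pose F k : set (lebesgueType R n) :=
  if unpickle k is Some q then [set y + s q | y in A] else set0.
have cover : [set: 'rV[R]_n.+1] = \bigcup_k F k.
  apply/seteqP; split => // y _.
  have [q yq] : {q : 'I_n.+1 -> rat &
      forall i, ratr (q i) \in `](y ord0 i - r), (y ord0 i + r)[}.
    apply: (@choice _ _ (fun i q =>
      ratr q \in `](y ord0 i - r), (y ord0 i + r)[)) => i.
    by apply: rat_in_itvoo; lra.
  exists (pickle (\row_i q i)) => //; rewrite /F pickleK.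
  exists (y - s (\row_i q i)); last by rewrite subrK.
  apply/UA/rU; split => // i j; rewrite (ord1 i) /ball/= !mxE.
  have := yq j; rewrite in_itv/= => /andP[? ?].
  by rewrite ltr_norml; lra.
apply/eqP; rewrite eq_le outer_measure_ge0 andbT cover.
apply: (le_trans (outer_measure_sigma_subadditive _ _)).
rewrite eseries0// => k _ _; apply/eqP; rewrite eq_le outer_measure_ge0 andbT.
rewrite /F; case: unpickle => [q|]; last by rewrite outer_measure0.
by rewrite -A0; exact: lebesgue_outer_shift_le.
Qed.

(* Otherwise every set is measurable, by completeness, and [J] has integral 0. *)
Lemma kernel_lebesgue_setT_neq0 (R : realType) (n : nat) (J : 'rV[R]_n.+1 -> R) :
  kernel_assumptions J -> lebesgue_outer [set: 'rV[R]_n.+1] != 0%E.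
Proof.
move=> hJ; apply/eqP => muT0; have := kernel_integral hJ.
rewrite null_set_integral//.
- by move/eqP; rewrite eq_sym onee_eq0.
- move=> _ Y _; apply: measure_is_complete_caratheodory.
  by exists setT; split => //; exact: measurableT.
Qed.

(** * Comparison of possibly infinite integrals *)

Lemma integral_le_cst_add d (X : measurableType d) (R : realType)
    (mu : {measure set X -> \bar R}) (D : set X) (f g : X -> R) (c : R) :
  measurable D -> (mu D < +oo)%E -> 0 <= c ->
  measurable_fun D f -> quasi_integrable mu D (fun x => (g x)%:E) ->
  (forall x, D x -> f x <= g x + c) ->
  (\int[mu]_(x in D) (f x)%:E <=
   \int[mu]_(x in D) (g x)%:E + (c * fine (mu D))%:E)%E.
Proof.
move=> mD muD c0 mf [mg gfin] fg.
have mf' : measurable_fun D (EFin \o f) by exact/measurable_EFinP.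
have mg' : measurable_fun D (EFin \o g) := mg.
set F := EFin \o f; set G := EFin \o g.
have mFp : measurable_fun D (F^\+)%E by exact: measurable_funepos.
have mFn : measurable_fun D (F^\-)%E by exact: measurable_funeneg.
have mGp : measurable_fun D (G^\+)%E by exact: measurable_funepos.
have mGn : measurable_fun D (G^\-)%E by exact: measurable_funeneg.
have muDE : mu D = (fine (mu D))%:E by rewrite fineK// ge0_fin_numE.
(* Both sides are moved so that only nonnegative integrals, possibly infinite,
   are added. *)
have key : (\int[mu]_(x in D) F^\+ x + \int[mu]_(x in D) G^\- x <=
    \int[mu]_(x in D) G^\+ x + \int[mu]_(x in D) F^\- x + (c * fine (mu D))%:E)%E.
  rewrite EFinM -muDE -(integral_cst _ mD).
  rewrite -!ge0_integralD//=; last 2 first.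
  - by move=> x _; rewrite adde_ge0.
  - exact: emeasurable_funD.
  apply: ge0_le_integral => //=.
  - by move=> x _; rewrite adde_ge0.
  - exact: emeasurable_funD.
  - by apply: emeasurable_funD => //; exact: emeasurable_funD.
  move=> x Dx; rewrite !funeposE !funenegE /F /G /=.
  rewrite -?EFinN -!EFin_max -!EFinD lee_fin.
  have max_le (a b : R) : a <= b + c ->
      Num.max a 0 + Num.max (- b) 0 <= Num.max b 0 + Num.max (- a) 0 + c.
    by clear - c0; rewrite /Num.max /Order.max; repeat case: ltP => ?; lra.
  exact/max_le/fg.
rewrite integralE [X in (_ <= X + _)%E]integralE.
have := integral_ge0 mu (fun x (_ : D x) => funepos_ge0 F x).
have := integral_ge0 mu (fun x (_ : D x) => funeneg_ge0 F x).
have := integral_ge0 mu (fun x (_ : D x) => funepos_ge0 G x).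
have := integral_ge0 mu (fun x (_ : D x) => funeneg_ge0 G x).
move: gfin key; rewrite -/F -/G.
(* Quasi-integrability excludes that both parts of [g] are infinite. If both parts of [f] are, the
   left side is [+oo - +oo], which evaluates to [-oo]. *)
move: (integral mu D F^\+%E) (integral mu D F^\-%E) (integral mu D G^\+%E)
  (integral mu D G^\-%E) => [a| |] [b| |] [e| |] [h| |] //=;
  rewrite ?lee_fin ?leey ?leNye//; try by case.
by move=> _ + _ _ _ _; clear - R; lra.
Qed.

(** * Almost everywhere bounds on the nonlinearity *)

(** If [f b < f a], then [f] stays above the mean [m] of the two values near [a] and below it near
    [b]. Rationals [p] and [q] there, kept apart by the midpoint of [a] and [b], contradict
    monotonicity on the rationals. *)
Lemma continuous_nondecreasing_rat (R : realType) (f : R -> R) :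
  continuous f -> (forall p q : rat, p < q -> f (ratr p) <= f (ratr q)) ->
  forall a b, a <= b -> f a <= f b.
Proof.
move=> cf frat a b; rewrite le_eqVlt => /predU1P[->//|ab].
rewrite leNgt; apply/negP => fba.
pose m := (f a + f b) / 2.
have /nbhs_ballP[r /= r0 ra] : nbhs a (f @^-1` [set y | m < y]).
  by apply: cf; apply: lt_nbhsr; rewrite /m; lra.
have /nbhs_ballP[s /= s0 sb] : nbhs b (f @^-1` [set y | y < m]).
  by apply: cf; apply: lt_nbhsl; rewrite /m; lra.
have [p] := rat_in_itvoo (ltac:(rewrite lt_min; apply/andP; split; lra) :
  a < Num.min (a + r) ((a + b) / 2)).
rewrite in_itv/= lt_min => /and3P[ap par pab].
have [q] := rat_in_itvoo (ltac:(rewrite gt_max; apply/andP; split; lra) :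
  Num.max (b - s) ((a + b) / 2) < b).
rewrite in_itv/= gt_max => /andP[/andP[bsq abq] qb].
have /frat : p < q by rewrite -(ltr_rat R); lra.
have /= : m < f (ratr p) by apply: ra; rewrite /ball/= ltr_norml; lra.
have /= : f (ratr q) < m by apply: sb; rewrite /ball/= ltr_norml; lra.
lra.
Qed.

(* For rational arguments the difference quotient bounds hold outside one null
   set; there, both [s |-> G x s * s] and [s |-> alpha * s - G x s * s] are
   nondecreasing on Q, hence on R by continuity. *)
Lemma nonlinearity_ae_le (R : realType) (n : nat) (G : 'rV[R]_n.+1 -> R -> R) :
  nonlinearity_assumptions G ->
  exists2 alpha : R, 0 <= alpha & {ae lebesgue_N, forall x : lebesgueType R n,
    forall a b d, 0 <= d -> a <= b + d -> G x a * a <= G x b * b + alpha * d}.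
Proof.
move=> hG.
have [alpha1 [alpha [alpha1_gt0 alpha12 quotG]]] := nonlinearity_bounds hG.
have aeF : Filter (almost_everywhere (@lebesgue_N R n)).
  exact: ae_filter_ringOfSetsType.
exists alpha; first by lra.
have ratG : {ae lebesgue_N, forall x : lebesgueType R n,
    forall p q : rat, p < q ->
    alpha1 <= (G x (ratr p) * ratr p - G x (ratr q) * ratr q) /
              (ratr p - ratr q) <= alpha}.
  (* The exceptional null set depends on the pair of arguments; numbering the rational pairs by
     [nat] lets countably many null sets be merged into one. *)
  pose P k (x : lebesgueType R n) :=
    if @unpickle (rat * rat)%type k is Some (p, q) then p < q ->
    alpha1 <= (G x (ratr p) * ratr p - G x (ratr q) * ratr q) /
              (ratr p - ratr q) <= alpha else True.
  have /ae_foralln : forall k, {ae lebesgue_N, forall x, P k x}.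
    move=> k; rewrite /P; case: unpickle => [[p q]|]; last exact: aeW.
    have [pq|pq] := ltP p q; last by apply: aeW => x //; rewrite ltNge pq.
    have pq_neq : ratr p != ratr q :> R by rewrite lt_eqF// ltr_rat.
    by apply: filterS (quotG _ _ pq_neq) => x + _.
  by apply: filterS => x Px p q; have := Px (pickle (p, q)); rewrite /P pickleK.
apply: filterS2 (nonlinearity_continuous hG) ratG => x cGx quotGx a b d d0 abd.
have cH : continuous (fun s => G x s * s).
  by move=> s; apply: cvgM; [exact: cGx|exact: cvg_id].
have quot p q : p < q -> 0 <= G x (ratr q) * ratr q - G x (ratr p) * ratr p
    <= alpha * (ratr q - ratr p).
  move=> pq; have := quotGx p q pq.
  have pq0 : 0 < ratr q - ratr p :> R by rewrite subr_gt0 ltr_rat.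
  rewrite -mulrNN -invrN !opprB => /andP[lo up].
  by move: lo up; rewrite ler_pdivlMr// ler_pdivrMr//; nra.
have H_le := continuous_nondecreasing_rat cH.
(* For [a <= b], monotonicity of [G x s * s] suffices. Otherwise its increment from [b] to [a] is at
   most [alpha * (a - b)], hence at most [alpha * d]. *)
have [ab|ba] := leP a b.
  rewrite (le_trans (H_le _ _ _ ab))//; last by nra.
  by move=> p q /quot; lra.
have K_mono : continuous (fun s => alpha * s - G x s * s).
  move=> s; apply: cvgB (cH s).
  by apply: cvgM; [exact: cvg_cst|exact: cvg_id].
have : alpha * (a - b) <= alpha * d by rewrite ler_wpM2l//; lra.
have : alpha * b - G x b * b <= alpha * a - G x a * a; last by lra.
apply: (continuous_nondecreasing_rat K_mono _ (ltW ba)) => p q /quot /=.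
by rewrite mulrBr; lra.
Qed.

(** * Boundedness of the kernel, and topology of [Omega_J] *)

Lemma kernel_eq0_out_supp (R : realType) (n : nat) (J : 'rV[R]_n.+1 -> R) z :
  ~ supp J z -> J z = 0.
Proof.
by move=> Jz; apply/eqP/negP => /negP Jz0; apply: Jz; exact: subset_closure.
Qed.

Lemma kernel_bounded (R : realType) (n : nat) (J : 'rV[R]_n.+1 -> R) :
  kernel_assumptions J -> exists2 M, 0 <= M & forall z, J z <= M.
Proof.
move=> hJ.
have /ex_strict_bound_gt0[M M0 JM] : bounded_set [set J z | z in supp J].
  apply: compact_bounded; apply: continuous_compact (kernel_compact_supp hJ).
  exact/continuous_subspaceT/kernel_continuous.
exists M => [|z]; first exact: ltW.
have [Jz|/kernel_eq0_out_supp->] := pselect (supp J z); last exact: ltW.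
by have := JM (J z) (ex_intro2 _ _ z Jz erefl) => /= /ltr_normlW/ltW.
Qed.

Lemma open_Omega_J (R : realType) (n : nat) (Omega : set 'rV[R]_n.+1) J :
  open Omega -> open (Omega_J Omega J).
Proof.
move=> oO; rewrite openE => _ [x Ox [z Jz <-]].
have /nbhs_ballP[r /= r0 rO] : nbhs x Omega by exact: open_nbhs_nbhs.
apply/nbhs_ballP; exists r => //= y; rewrite -ball_normE /= => xzy.
exists (y - z); last by exists z => //; rewrite subrK.
by apply: rO; rewrite -ball_normE /= opprB addrA.
Qed.

Lemma bounded_Omega_J (R : realType) (n : nat) (Omega : set 'rV[R]_n.+1) J :
  bounded_set Omega -> compact (supp J) -> bounded_set (Omega_J Omega J).
Proof.
move=> /ex_strict_bound_gt0[M M0 OM].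
move=> /compact_bounded/ex_strict_bound_gt0[K K0 JK].
exists (M + K); split; first exact: num_real.
move=> N MKN _ [x Ox [z Jz <-]] /=.
rewrite (le_trans _ (ltW MKN))// (le_trans (ler_normD _ _))// lerD// ltW//.
- exact: OM.
- exact: JK.
Qed.

Lemma bounded_closure (R : realType) (n : nat) (A : set 'rV[R]_n.+1) :
  bounded_set A -> bounded_set (closure A).
Proof.
move=> [M [Mr AM]]; exists M; split => // N MN.
suff : closure A `<=` [set x | `|x| <= N] by [].
rewrite -[X in _ `<=` X](_ : closure [set x : 'rV[R]_n.+1 | `|x| <= N] = _).
  exact/closure_subset/AM.
apply/esym/closure_id.
apply: closed_comp (@closed_le R N) => x _; exact: norm_continuous.
Qed.

(** * Comparison of the nonlocal operators of [u] and [v] *)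

(** With [d = m - (u x t - v x t)], each increment of [u] from [x] exceeds that of [v] by at most
    [d], so the integrands differ by at most [M * alpha * d]. As [G] is evaluated at the base point,
    its bounds are required at this single [x]. *)
Lemma nonlocal_operator_le_add (R : realType) (n : nat) (Omega : set 'rV[R]_n.+1)
    (J : 'rV[R]_n.+1 -> R) (G : 'rV[R]_n.+1 -> R -> R)
    (u v : 'rV[R]_n.+1 -> R -> R) (x : 'rV[R]_n.+1) (t alpha M m : R) :
  measurable (Omega_J Omega J : set (lebesgueType R n)) ->
  (lebesgue_outer (Omega_J Omega J) < +oo)%E ->
  (forall z, 0 <= J z <= M) -> 0 <= alpha ->
  (forall a b d, 0 <= d -> a <= b + d -> G x a * a <= G x b * b + alpha * d) ->
  quasi_integrable lebesgue_N (Omega_J Omega J) (nonlocal_integrand J G u x t) ->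
  quasi_integrable lebesgue_N (Omega_J Omega J) (nonlocal_integrand J G v x t) ->
  (forall y, Omega_J Omega J y -> u y t - v y t <= m) -> u x t - v x t <= m ->
  (nonlocal_operator Omega J G u x t <= nonlocal_operator Omega J G v x t +
    (M * alpha * (m - (u x t - v x t)) *
     fine (lebesgue_outer (Omega_J Omega J)))%:E)%E.
Proof.
move=> mD muD JM alpha0 Gx [mu _] qv wm wxm.
apply: (@integral_le_cst_add _ _ _ lebesgue_N) => //.
- have /andP[J0 JMx] := JM 0; rewrite !mulr_ge0 ?subr_ge0//; lra.
- exact/measurable_EFinP.
move=> y Dy; have /andP[J0 JMy] := JM (x - y).
rewrite -!(mulrA (J _)) ![(_ - _) * G _ _]mulrC.
have d0 : 0 <= m - (u x t - v x t) by rewrite subr_ge0.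
have := Gx (u y t - u x t) (v y t - v x t) _ d0.
have := wm y Dy => wy /(_ ltac:(lra)) Guv.
have := ler_wpM2l J0 Guv; rewrite mulrDr.
have := ler_wpM2r (mulr_ge0 alpha0 d0) JMy.
lra.
Qed.

(** The null set comes from [G] alone, so it serves all [t] and [m] at once. The bound [m] need not
    be attained at [x]: it will be the value at the maximum point, while [x] is a nearby point. *)
Lemma sub_super_derive1_le (R : realType) (n : nat) (Omega : set 'rV[R]_n.+1)
    (T : R) (J : 'rV[R]_n.+1 -> R) (G : 'rV[R]_n.+1 -> R -> R)
    (h1 h2 : 'rV[R]_n.+1 -> R -> R) (u0 v0 : 'rV[R]_n.+1 -> R)
    (u v : 'rV[R]_n.+1 -> R -> R) :
  open Omega -> bounded_set Omega ->
  kernel_assumptions J -> nonlinearity_assumptions G ->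
  regular_subsolution Omega J G T h1 u0 u ->
  regular_supersolution Omega J G T h2 v0 v ->
  exists2 K, 0 <= K & {ae lebesgue_N, forall x : lebesgueType R n,
    closure Omega x ->
    forall t m, t \in `]0, T[ ->
    (forall y, Omega_J Omega J y -> u y t - v y t <= m) -> u x t - v x t <= m ->
    derive1 (u x) t - derive1 (v x) t <= K * (m - (u x t - v x t))}.
Proof.
move=> oO bO hJ hG hu hv.
have mD := open_lebesgue_measurable (open_Omega_J (J := J) oO).
have muD := lebesgue_outer_bounded_lty
  (bounded_Omega_J bO (kernel_compact_supp hJ)).
have [M M0 JM] := kernel_bounded hJ.
have [alpha alpha0 Galpha] := nonlinearity_ae_le hG.
exists (M * alpha * fine (lebesgue_outer (Omega_J Omega J))).
  by rewrite !mulr_ge0// fine_ge0// outer_measure_ge0.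
have aeF : Filter (almost_everywhere (@lebesgue_N R n)).
  exact: (ae_filter_ringOfSetsType lebesgue_N).
apply: filterS Galpha => x Gx Ox t m tT wm wxm.
have JM' z : 0 <= J z <= M by rewrite (kernel_ge0 hJ) JM.
have := nonlocal_operator_le_add mD muD JM' alpha0 Gx
  (regular_integral (subsolution_regular hu) Ox tT)
  (regular_integral (supersolution_regular hv) Ox tT) wm wxm.
move=> /(le_trans (subsolution_equation hu Ox tT)) le1.
have := leeD2r (M * alpha * (m - (u x t - v x t)) *
  fine (lebesgue_outer (Omega_J Omega J)))%:E (supersolution_equation hv Ox tT).
by move=> /(le_trans le1); rewrite -EFinD lee_fin; lra.
Qed.

(** * Tools for the argument at the maximum point *)

(** Left difference quotients of [f] at [t] are at least [e]. Only earlier times enter, since the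
    maximum may sit at the final time of the interval. *)
Lemma derive1_ge_left_max (R : realType) (f : R -> R) (t e : R) :
  0 < t -> derivable f t 1 ->
  (forall s, 0 <= s <= t -> f s - e * s <= f t - e * t) -> e <= derive1 f t.
Proof.
move=> t0 df fmax; rewrite leNgt; apply/negP => dfe.
have quotE : (fun h => h^-1 *: ((f \o shift t) (h *: 1) - f t)) =
    (fun h => h^-1 *: (f (h + t) - f t)).
  by apply/funext => h; rewrite /= [h *: 1]mulr1.
move: df; rewrite /derivable quotE => /cvgr_lt/(_ _ dfe).
move=> /nbhs_ballP[r /= r0 rq].
(* Small enough for [- h] to lie in the ball of radius [r] and for [t - h] to remain nonnegative. *)
pose h := Num.min r t / 2.
have m0 : 0 < Num.min r t by rewrite lt_min r0 t0.
have [mr mt] : Num.min r t <= r /\ Num.min r t <= t by rewrite !ge_min !lexx orbT.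
have /= := rq (- h) _ _; rewrite /ball/= sub0r opprK ger0_norm /h; last by lra.
have h0 : 0 < h by rewrite /h; lra.
move=> /(_ ltac:(lra)) /(_ ltac:(lra)).
rewrite -/h [_ *: _]mulrC invrN mulrN -mulNr opprB ltr_pdivrMr//.
have := fmax (- h + t) (ltac:(rewrite /h; lra)).
lra.
Qed.

Lemma open_ae_exists (R : realType) (n : nat) (U : set 'rV[R]_n.+1)
    (P : 'rV[R]_n.+1 -> Prop) :
  lebesgue_outer [set: 'rV[R]_n.+1] != 0%E -> open U -> U !=set0 ->
  {ae lebesgue_N, forall x : lebesgueType R n, P x} -> exists2 x, U x & P x.
Proof.
move=> muT oU U0 aeP; apply: contrapT => noP.
apply: (open_not_negligible muT oU U0).
case: aeP => A [mA A0 PA]; exists A; split => // x Ux; apply: PA => /= Px.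
by apply: noP; exists x.
Qed.

Lemma within_continuous_lt (R : realType) (X : topologicalType) (A : set X)
    (f : X -> R) (x : X) (c : R) :
  {within A, continuous f} -> A x -> c < f x ->
  \forall y \near x, A y -> c < f y.
Proof.
move=> cf Ax cfx.
have : nbhs (x : subspace A) (f @^-1` [set y | c < y]) by exact/cf/lt_nbhsr.
by rewrite /nbhs/= -nbhs_subspace_in// => /(@withinP _ _).
Qed.

Theorem theorem2p5 (R : realType) (n : nat) (Omega : set 'rV[R]_n.+1) (T : R)
    (J : 'rV[R]_n.+1 -> R) (G : 'rV[R]_n.+1 -> R -> R)
    (h1 h2 : 'rV[R]_n.+1 -> R -> R) (u0 v0 : 'rV[R]_n.+1 -> R)
    (u v : 'rV[R]_n.+1 -> R -> R) :
  bounded_domain Omega -> 0 < T ->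
  kernel_assumptions J -> nonlinearity_assumptions G ->
  regular_subsolution Omega J G T h1 u0 u ->
  regular_supersolution Omega J G T h2 v0 v ->
  (forall (x : 'rV[R]_n.+1) (t : R), exterior Omega J x -> t \in `]0, T[ -> h1 x t <= h2 x t) ->
  (forall x : 'rV[R]_n.+1, closure Omega x -> u0 x <= v0 x) ->
  forall (x : 'rV[R]_n.+1) (t : R), closure Omega x -> t \in `[0, T] -> u x t <= v x t.
Proof.
move=> [_ oO _ bO] T0 hJ hG hu hv h12 uv0.
have [ru rv] := (subsolution_regular hu, supersolution_regular hv).
pose w x t := u x t - v x t.
have cw : {within closure Omega `*` `[0, T], continuous (fun p => w p.1 p.2)} :=
  within_continuousB (regular_continuous ru) (regular_continuous rv).
have cwt : {within closure Omega `*` `]0, T[,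
    continuous (fun p => derive1 (u p.1) p.2 - derive1 (v p.1) p.2)} :=
  within_continuousB (regular_derivative_continuous ru)
    (regular_derivative_continuous rv).
(* The differential inequalities hold only at times in []0, T[], so final times below [T] are
   treated first; time [T] follows by continuity of [w]. *)
suff wle0 x t : closure Omega x -> 0 <= t < T -> w x t <= 0.
  move=> x t Ox; rewrite in_itv/= => /andP[t0].
  rewrite le_eqVlt => /predU1P[->|tT];
    last by rewrite -subr_le0 wle0 ?t0.
  rewrite -subr_le0 leNgt; apply/negP => wT.
  have /= := within_continuous_lt cw (x := (x, T)) _ wT.
  rewrite /= in_itv/= lexx (ltW T0) => /(_ (conj Ox isT)) /nbhs_ballP[r /= r0 rw].
  pose s := T - Num.min r T / 2.
  have m0 : 0 < Num.min r T by rewrite lt_min r0 T0.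
  have [mr mt] : Num.min r T <= r /\ Num.min r T <= T.
    by rewrite !ge_min !lexx orbT.
  have : 0 < w x s.
    apply: (rw (x, s)).
      by split; [exact: ballxx|rewrite /ball/= ltr_norml /s; lra].
    by split => //=; rewrite in_itv/= /s; lra.
  by rewrite ltNge wle0// /s; lra.
move=> Ox /andP[t0 tT]; rewrite leNgt; apply/negP => wxt.
have [K K0 wK] := sub_super_derive1_le oO bO hJ hG hu hv.
(* This makes [w - e t] positive at [(x, t)]; adding 1 to [t] avoids a zero denominator when
   [t = 0]. *)
pose e := w x t / (2 * (t + 1)).
have e0 : 0 < e by rewrite divr_gt0//; lra.
have et : e * t < w x t.
  by rewrite /e mulrAC ltr_pdivrMr; nra.
pose A := closure Omega `*` `[0, t]%classic.
have compA : compact A.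
  apply: compact_setX; last exact: segment_compact.
  apply: bounded_closed_compact; last exact: closed_closure.
  exact: bounded_closure.
have cA : {within A, continuous (fun p => w p.1 p.2 - e * p.2)}.
  apply: within_continuousB; first apply: continuous_subspaceW cw.
    by move=> p [Op]; rewrite /= !in_itv/= => /andP[? ?]; split => //=; lra.
  apply: continuous_subspaceT => p; apply: cvgM; [exact: cvg_cst|exact: cvg_snd].
have A0 : A !=set0 by exists (x, t); split => //=; rewrite in_itv/= t0 lexx.
have [[x0 t1]] := compact_EVT_max A0 compA cA.
rewrite inE => -[/= Ox0]; rewrite in_itv/= => /andP[t1_ge0 t1t] wmax.
have wmax' y s : closure Omega y -> 0 <= s <= t ->
    w y s - e * s <= w x0 t1 - e * t1.
  by move=> Oy st; apply: (wmax (y, s)); rewrite inE; split.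
(* Positivity at the maximum excludes [t1 = 0], by the order of the initial data, and dominates the
   exterior values, where [w <= 0]. *)
have wx0 : 0 < w x0 t1.
  have := wmax' x t Ox (ltac:(rewrite t0 lexx)).
  have : 0 <= e * t1 by rewrite mulr_ge0// ltW.
  lra.
have t1_gt0 : 0 < t1.
  rewrite lt_neqAle t1_ge0 andbT; apply/eqP => t1E.
  move: wx0; rewrite -t1E /w subr_gt0 ltNge.
  rewrite (le_trans (subsolution_initial hu Ox0))// (le_trans (uv0 _ Ox0))//.
  exact: supersolution_initial hv _ Ox0.
have t1T : t1 \in `]0, T[ by rewrite in_itv/= t1_gt0 (le_lt_trans t1t).
have [du dv] := (regular_derivable ru Ox0 t1T, regular_derivable rv Ox0 t1T).
have wt_ge : e <= derive1 (u x0) t1 - derive1 (v x0) t1.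
  rewrite !derive1E -deriveB// -derive1E; apply: derive1_ge_left_max => //.
    exact: derivableB.
  by move=> s st; apply: wmax' => //; lra.
have wle y : Omega_J Omega J y -> w y t1 <= w x0 t1.
  move=> Jy; have [Oy|nOy] := pselect (closure Omega y).
    by have := wmax' y t1 Oy (ltac:(rewrite t1_ge0 t1t)); lra.
  have ey : exterior Omega J y by [].
  rewrite (le_trans _ (ltW wx0))// /w subr_le0.
  rewrite (le_trans (subsolution_boundary hu ey t1T))//.
  rewrite (le_trans (h12 _ _ ey t1T))//.
  exact: supersolution_boundary hv _ _ ey t1T.
(* The margins are matched: a drop of [w] below [e / (2 * (K + 1))], multiplied by [K], is at most
   [e / 2], whereas [w_t] stays above [e / 2]. Again [K + 1] avoids dividing by 0. *)
have near1 : \forall p \near (x0, t1), (closure Omega `*` `]0, T[) p ->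
    e / 2 < derive1 (u p.1) p.2 - derive1 (v p.1) p.2.
  by apply: (within_continuous_lt cwt) => //=; lra.
have near2 : \forall p \near (x0, t1), (closure Omega `*` `[0, T]) p ->
    w x0 t1 - e / (2 * (K + 1)) < w p.1 p.2.
  apply: (within_continuous_lt cw) => /=.
    by split => //; rewrite in_itv/=; lra.
  by rewrite ltrBlDr ltrDl divr_gt0//; lra.
have [r /= r0 rP] : exists2 r : R, 0 < r & forall y, ball x0 r y -> Omega y ->
    e / 2 < derive1 (u y) t1 - derive1 (v y) t1 /\
    w x0 t1 - e / (2 * (K + 1)) < w y t1.
  have /nbhs_ballP[r1 /= r1_gt0 rP1] := near1.
  have /nbhs_ballP[r2 /= r2_gt0 rP2] := near2.
  exists (Num.min r1 r2); first by rewrite lt_min r1_gt0.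
  move=> y yr Oy; have Oy' : closure Omega y by exact: subset_closure.
  split.
    apply: (rP1 (y, t1)) => //; split; last exact: ballxx.
    by apply: le_ball yr; rewrite ge_min lexx.
  apply: (rP2 (y, t1)); last first.
    by split; [exact: Oy'|rewrite /= in_itv/= t1_ge0 (le_trans t1t) ?ltW].
  split; last exact: ballxx.
  by apply: le_ball yr; rewrite ge_min lexx orbT.
have oU : open (ball x0 r `&` Omega) by apply: openI => //; exact: ball_open.
have U0 : ball x0 r `&` Omega !=set0.
  by rewrite setIC; apply: Ox0; exact: nbhsx_ballx.
(* The bounds on [G] may fail at [x0] itself, so the estimate is applied at a nearby good point [y]
   of [Omega], with [w x0 t1] as the bound [m]. *)
have [y [yr Oy]] := open_ae_exists (kernel_lebesgue_setT_neq0 hJ) oU U0 wK.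
have Oy' : closure Omega y by exact: subset_closure.
have wy : w y t1 <= w x0 t1.
  by have := wmax' y t1 Oy' (ltac:(rewrite t1_ge0 t1t)); lra.
move=> /(_ Oy' t1 _ t1T wle wy).
have [P1 P2] := rP y yr Oy.
have : K * (w x0 t1 - w y t1) <= K * (e / (2 * (K + 1))).
  by rewrite ler_wpM2l//; lra.
have : K * (e / (2 * (K + 1))) <= e / 2.
  rewrite mulrA ler_pdivrMr; nra.
rewrite -/(w y t1); lra.
Qed.
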